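(* For every positive integer $n$, every internal zero $c$ of the sequence $(S_{n,132}(c))_{c\ge0}$ satisfies $c\in\{M_{n,132}-1,\,M_{n,132}-2\}$, and $M_{n,132}-1$ and $M_{n,132}-2$ are not both internal zeros.
   Context: For $p\in S_n$, $c_{132}(p)$ is the number of subsequences $p_ip_jp_k$ ($i<j<k$) with $p_i<p_k<p_j$; $S_{n,132}(c)$ is the number of $p\in S_n$ with $c_{132}(p)=c$; $M_{n,132}=\max_{p\in S_n}c_{132}(p)$. An integer $c$ is an internal zero if $S_{n,132}(c)=0$ but there exist $c_1<c<c_2$ with $S_{n,132}(c_1),S_{n,132}(c_2)\ne 0$. *)

(* Defs.v *)
From mathcomp Require Import all_boot all_fingroup.

Set Implicit Arguments.
Unset Strict Implicit.
Unset Printing Implicit Defensive.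

(* A permutation p in S_n is read as the word p 0, p 1, ..., p (n - 1); shifting
   positions and values from {1..n} to {0..n-1} does not affect patterns. *)
Definition c132 (n : nat) (p : 'S_n) : nat :=
  #|[set t : 'I_n * 'I_n * 'I_n |
      let: (i, j, k) := t in
      [&& i < j, j < k, p i < p k & p k < p j]]|.

Definition S132 (n c : nat) : nat := #|[set p : 'S_n | c132 p == c]|.

Definition M132 (n : nat) : nat := \max_(p : 'S_n) c132 p.

(* Only c : nat is relevant: c1 < c with c1 an index of the sequence forces
   c > 0. *)
Definition internal_zero (n c : nat) : Prop :=
  S132 n c = 0 /\
  exists c1 c2 : nat, [/\ c1 < c, c < c2, S132 n c1 <> 0 & S132 n c2 <> 0].

(* Main.v *)
(* Upper bound: the copies of 132 in p are the cones (i below two incomparable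
   points j, k) of the poset on positions where i < j iff both the positions
   and the values increase. Replacing all maximal points by clones of the best
   one does not decrease the number of cones; iterating until the maximal
   points lie above everything else gives M_n <= max_k (M_k + k C(n - k, 2)).

   Attained values: placing a 132-avoider of length n - k with j inversions
   above and after a permutation of length k having a copies gives a + k j
   copies, for any j <= C(n - k, 2). If the optimal k is at least 6, then
   induction on n shows that every r < k is attained at length k, so that all
   of [0, k C(n - k, 2)] is attained, and what is above is a translate of
   [0, M_k], with the same exceptions. The optimal k is at least 6 when
   n >= 16; for n < 16 the same recursion, with the single additional value 17
   at n = 7, is evaluated. *)
Require Import Defs.
From mathcomp Require Import all_boot all_fingroup.
From mathcomp Require Import zify.

Set Implicit Arguments.
Unset Strict Implicit.
Unset Printing Implicit Defensive.

(** * Inversions and copies of 132 in words, and values attained by direct sums *)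

Fixpoint invs (s : seq nat) : nat :=
  if s is x :: s' then count (fun y => y < x) s' + invs s' else 0.

Fixpoint occ132 (s : seq nat) : nat :=
  if s is x :: s' then invs [seq y <- s' | x < y] + occ132 s' else 0.

Lemma invs_cat (s1 s2 : seq nat) :
  {in s1 & s2, forall x y, x < y} -> invs (s1 ++ s2) = invs s1 + invs s2.
Proof.
elim: s1 => //= x s1 IH lt12; rewrite count_cat IH; last first.
  by move=> y z ys zs; apply: lt12 => //; rewrite inE ys orbT.
suff /eqP -> : count (fun y => y < x) s2 == 0 by rewrite addn0 addnA.
rewrite -leqn0 leqNgt -has_count; apply/hasPn => y ys.
by rewrite -leqNgt ltnW // lt12 ?mem_head.
Qed.

(** A copy meeting both words has only its 1 in [s1]: with the 3 in [s1] and the 2 in [s2], the 2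
    would exceed the 3. The 3 and 2 then form an arbitrary inversion of [s2]. *)
Lemma occ132_cat (s1 s2 : seq nat) :
  {in s1 & s2, forall x y, x < y} ->
  occ132 (s1 ++ s2) = occ132 s1 + size s1 * invs s2 + occ132 s2.
Proof.
elim: s1 => //= x s1 IH lt12; rewrite IH; last first.
  by move=> y z ys zs; apply: lt12 => //; rewrite inE ys orbT.
have fs2 : [seq y <- s2 | x < y] = s2.
  by apply/all_filterP/allP => y ys; rewrite lt12 ?mem_head.
rewrite filter_cat fs2 invs_cat; first by lia.
move=> y z; rewrite mem_filter => /andP[_ ys] zs.
by apply: lt12 => //; rewrite inE ys orbT.
Qed.

Lemma invs_shift (k : nat) (s : seq nat) : invs (map (addn k) s) = invs s.
Proof.
elim: s => //= x s ->; congr (_ + _); rewrite count_map.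
by apply: eq_count => y /=; rewrite ltn_add2l.
Qed.

Lemma occ132_shift (k : nat) (s : seq nat) :
  occ132 (map (addn k) s) = occ132 s.
Proof.
elim: s => //= x s ->; congr (_ + _); rewrite filter_map invs_shift.
by congr invs; apply: eq_filter => y /=; rewrite ltn_add2l.
Qed.

Definition attained (n c : nat) : Prop :=
  exists2 s : seq nat, perm_eq s (iota 0 n) & occ132 s = c.

(** Induction on [m]: the new largest entry goes last, adding no inversion, or first, adding [m] of
    them. Neither place creates a copy of 132. *)
Lemma exists_avoider (m j : nat) : j <= 'C(m, 2) ->
  exists s : seq nat, [/\ perm_eq s (iota 0 m), occ132 s = 0 & invs s = j].
Proof.
elim: m j => [|m IH] j.
  by rewrite bin0n leqn0 => /eqP ->; exists [::].
rewrite binS bin1 => lej.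
have [ltj|gej] := leqP j 'C(m, 2).
  have [s [ps os is_]] := IH _ ltj; exists (s ++ [:: m]).
  have lt_s : {in s & [:: m], forall x y, x < y}.
    by move=> x y; rewrite (perm_mem ps) mem_iota inE => /andP[_ ltx] /eqP ->.
  split.
  - by rewrite -addn1 iotaD perm_cat2r.
  - by rewrite occ132_cat //= os muln0.
  - by rewrite invs_cat ?is_ ?addn0.
(* ['C(m, 2)] is at least [m - 1], and [j] exceeds it. *)
have gem : m <= j.
  apply: leq_trans gej; case: (m) => // m'; rewrite binS bin1; exact: leq_addl.
have [|s [ps os is_]] := IH (j - m); first by rewrite leq_subLR addnC.
have lt_m : {in s, forall x, x < m}.
  by move=> x; rewrite (perm_mem ps) mem_iota => /andP[].
exists (m :: s); split.
- by rewrite -addn1 iotaD perm_sym perm_catC perm_cons perm_sym.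
- rewrite /= os (_ : [seq y <- s | m < y] = [::]) //.
  apply/eqP; rewrite -(negbK (_ == _)) -has_filter; apply/hasPn => x /lt_m.
  by rewrite -leqNgt => /ltnW.
- rewrite /= is_ (_ : count _ s = m) ?subnKC //.
  rewrite -[RHS](size_iota 0) -(perm_size ps); apply/eqP.
  by rewrite -all_count; apply/allP.
Qed.

Lemma attained_sum (k m a j : nat) :
  attained k a -> j <= 'C(m, 2) -> attained (k + m) (a + k * j).
Proof.
move=> [s ps os] /exists_avoider[t [pt ot it]].
exists (s ++ map (addn k) t).
  rewrite iotaD -[0 + k]addnC iotaDl; apply: perm_cat => //.
  exact: perm_map.
rewrite occ132_cat; last first.
  move=> x y; rewrite (perm_mem ps) mem_iota => /andP[_ ltxk] /mapP[z _ ->].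
  exact: ltn_addr.
by rewrite invs_shift occ132_shift os ot it addn0 (perm_size ps) size_iota.
Qed.

(** * From words to permutations, by sums over triples of positions *)

Definition triple132 (s : seq nat) (i j k : nat) : bool :=
  [&& i < j, j < k, nth 0 s i < nth 0 s k & nth 0 s k < nth 0 s j].

Lemma count_sum (a : pred nat) (s : seq nat) :
  count a s = \sum_(i < size s) a (nth 0 s i).
Proof. by rewrite -sum1_count big_mkcond (big_nth 0) big_mkord. Qed.

(** Filtering preserves relative order, so inversions of the filtered word can be indexed by
    positions of the full word. This handles the filter inside [occ132]. *)
Lemma invs_filter_sum (a : pred nat) (s : seq nat) :
  invs [seq y <- s | a y] =
  \sum_(j < size s) \sum_(k < size s)
     [&& j < k, a (nth 0 s k), a (nth 0 s j) & nth 0 s k < nth 0 s j].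
Proof.
elim: s => [|x s IH]; first by rewrite big_ord0.
rewrite /= big_ord_recl /= big_ord_recl /= add0n.
under [X in _ = _ + X]eq_bigr => j _ do rewrite big_ord_recl /= add0n.
rewrite -IH; case: ifP => ax /=.
  congr (_ + _); rewrite count_filter count_sum; apply: eq_bigr => k _ /=.
  by rewrite andbC.
by rewrite big1 // => k _; rewrite andbF.
Qed.

Lemma occ132_sum (s : seq nat) :
  occ132 s = \sum_(i < size s) \sum_(j < size s) \sum_(k < size s)
                triple132 s i j k.
Proof.
elim: s => [|x s IH]; first by rewrite big_ord0.
rewrite /= big_ord_recl; congr (_ + _).
  rewrite invs_filter_sum [RHS]big_ord_recl [X in _ = X + _]big1 ?add0n //.
  apply: eq_bigr => j _; rewrite big_ord_recl add0n; apply: eq_bigr => k _.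
  rewrite /triple132 /= ltnS; case: (j < k) => //=.
  case: (ltnP x (nth 0 s k)) => //= ltx.
  case: (ltnP (nth 0 s k)) => //= ltk; rewrite ?andbF // andbT.
  by rewrite (ltn_trans ltx).
rewrite IH; apply: eq_bigr => i _; rewrite big_ord_recl.
rewrite [X in X + _]big1 ?add0n //; apply: eq_bigr => j _.
by rewrite big_ord_recl /triple132 /= andbF add0n.
Qed.

Lemma c132_sum (n : nat) (p : 'S_n) :
  c132 p = \sum_(i < n) \sum_(j < n) \sum_(k < n)
     [&& i < j, j < k, p i < p k & p k < p j].
Proof.
rewrite /c132 -sum1dep_card big_mkcond /= pair_bigA /= pair_bigA /=.
by apply: eq_bigr => -[[i j] k] _ /=; case: ifP.
Qed.

Lemma attained_perm (n c : nat) : attained n c -> exists p : 'S_n, c132 p = c.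
Proof.
move=> [s ps <-].
have sz : size s = n by rewrite (perm_size ps) size_iota.
have us : uniq s by rewrite (perm_uniq ps) iota_uniq.
have lt_s (i : 'I_n) : nth 0 s i < n.
  have := mem_nth 0 (_ : i < size s); rewrite sz (perm_mem ps) mem_iota.
  by move=> /(_ (ltn_ord i)).
have inj_f : injective (fun i : 'I_n => Ordinal (lt_s i)).
  move=> i j [/eqP]; rewrite nth_uniq ?sz // => /eqP; exact: val_inj.
exists (perm inj_f); rewrite c132_sum occ132_sum sz.
apply: eq_bigr => i _; apply: eq_bigr => j _; apply: eq_bigr => k _.
by rewrite !permE.
Qed.

(** * The recursion for the layered maximum *)

Lemma double_bin2 (n : nat) : 'C(n, 2).*2 = n * n.-1.
Proof.
by rewrite bin2 -[RHS]odd_double_half; case: n => //= n; rewrite oddM /= andNb.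
Qed.

(* [maxlay n] is the maximum of [c132] over layered permutations of length [n],
   defined through a table so that it can be computed. *)
Fixpoint maxlay_table (n : nat) : seq nat :=
  if n is m.+1 then
    let t := maxlay_table m in
    rcons t (foldr maxn 0 [seq nth 0 t k + k * 'C(m - k, 2) | k <- iota 0 m])
  else [::].

Definition maxlay (n : nat) : nat := nth 0 (maxlay_table n.+1) n.

Lemma size_maxlay_table (n : nat) : size (maxlay_table n) = n.
Proof. by elim: n => //= n IH; rewrite size_rcons IH. Qed.

Lemma nth_maxlay_table (n k : nat) :
  k < n -> nth 0 (maxlay_table n) k = maxlay k.
Proof.
elim: n => // n IH; rewrite ltnS leq_eqVlt => /predU1P[-> // | ltk].
by rewrite /= nth_rcons size_maxlay_table ltk IH.
Qed.

Lemma maxlayE (n : nat) :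
  maxlay n = \max_(k < n) (maxlay k + k * 'C(n - k, 2)).
Proof.
rewrite /maxlay /= nth_rcons size_maxlay_table ltnn eqxx.
rewrite foldrE big_map.
rewrite -(big_mkord xpredT (fun k => maxlay k + k * 'C(n - k, 2))).
rewrite /index_iota subn0; apply: eq_big_seq => k; rewrite mem_iota => /= ltk.
by rewrite nth_maxlay_table.
Qed.

Lemma leq_maxlay (n k : nat) :
  k < n -> maxlay k + k * 'C(n - k, 2) <= maxlay n.
Proof.
move=> ltk; rewrite [leqRHS]maxlayE.
pose F (i : 'I_n) := maxlay i + i * 'C(n - i, 2).
exact: (leq_bigmax (F := F) (Ordinal ltk)).
Qed.

Lemma maxlay_attained (n : nat) : 0 < n ->
  exists2 k, k < n & maxlay n = maxlay k + k * 'C(n - k, 2).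
Proof.
move=> n_gt0; rewrite maxlayE.
have [|k ->] := eq_bigmax (fun k : 'I_n => maxlay k + k * 'C(n - k, 2)).
  by rewrite card_ord.
by exists k.
Qed.

(** * Cones in finite posets and symmetrization of maximal points *)

Section Cones.
Variable T : finType.
Implicit Types (r : rel T) (S Q : {set T}).

(** An irreflexive [r] satisfies [~~ r j j], hence the explicit [j != k]. *)
Definition cone r (i j k : T) : bool :=
  [&& r i j, r i k, j != k, ~~ r j k & ~~ r k j].

Lemma coneC r i j k : cone r i j k = cone r i k j.
Proof.
rewrite /cone [k == j]eq_sym.
by case: (j == k) (r i j) (r i k) (r j k) (r k j) => [] [] [] [] [].
Qed.

Definition cones r S : nat :=
  \sum_(i in S) \sum_(j in S) \sum_(k in S) cone r i j k.

(* Transitivity is only required on [S], which is all that [clone] preserves. *)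
Definition order_on r S : Prop :=
  (forall x, ~~ r x x) /\
  {in S & &, forall x y z, r x y -> r y z -> r x z}.

Definition maximals r S : {set T} :=
  [set x in S | [forall y in S, ~~ r x y]].

Lemma maximalsP r S x :
  reflect (x \in S /\ {in S, forall y, ~~ r x y}) (x \in maximals r S).
Proof.
rewrite inE; apply: (iffP andP) => -[xS].
  by move/forall_inP.
by move=> H; split=> //; apply/forall_inP.
Qed.

Lemma maximals_sub r S : maximals r S \subset S.
Proof. by apply/subsetP => x /maximalsP[]. Qed.

Lemma disjoint_setDl (A B : {set T}) : [disjoint A :\: B & B].
Proof. by rewrite disjoints_subset setDE subsetIr. Qed.

Lemma setDUK (A B : {set T}) : B \subset A -> A :\: B :|: B = A.
Proof. by move=> sBA; rewrite -[RHS](setID A B) (setIidPr sBA) setUC. Qed.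

(** A point with the most predecessors in [S] is maximal: a point above it would have all of these
    and the point itself. *)
Lemma exists_maximal r S : order_on r S -> S != set0 ->
  exists x, x \in maximals r S.
Proof.
move=> [irr tr] /set0Pn[x0 x0S].
case: (arg_maxnP (fun x => #|[set y in S | r y x]|) x0S) => x xS xmax.
exists x; apply/maximalsP; split=> // z zS; apply/negP => rxz.
have /= := xmax z zS; rewrite /geq /= leqNgt => /negP; apply.
apply/proper_card/properP; split.
  apply/subsetP => y; rewrite !inE => /andP[yS ryx]; rewrite yS /=.
  exact: (tr y x z).
by exists x; rewrite !inE ?rxz ?(negPf (irr x)) ?andbF ?andbT.
Qed.

Definition below r S a : {set T} := [set i in S | r i a].

(* Counts the cones with one upper point [a] and the other points in [Q], twice
   since [cones] orders the upper points. *)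
Definition legs r Q a : nat :=
  (\sum_(i in Q) \sum_(j in Q) [&& r i a, r i j & ~~ r j a]).*2.

(** Cones are sorted by how many upper points lie in [A]: none, one or two. Nothing lies above a
    point of [A], so the lower point is in [Q], and two distinct points of [A] form a cone with each
    common predecessor. *)
Lemma cones_split r (Q A : {set T}) : [disjoint Q & A] ->
  (forall a y, a \in A -> y \in Q :|: A -> ~~ r a y) ->
  cones r (Q :|: A) =
  cones r Q + \sum_(a in A) legs r Q a +
  \sum_(a in A) \sum_(b in A | a != b) #|below r Q a :&: below r Q b|.
Proof.
move=> dQA maxA.
have neq j k : j \in Q -> k \in A -> (j != k) /\ (k != j).
  move=> jQ kA; suff jk : j != k by rewrite [k == j]eq_sym jk.
  by apply: contraTneq jQ => ->; rewrite (disjointFl dQA).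
have bigU F : \sum_(i in Q :|: A) F i = \sum_(i in Q) F i + \sum_(i in A) F i.
  by rewrite -bigU //; apply: eq_bigl => i; rewrite !inE.
have -> : cones r (Q :|: A) = \sum_(i in Q) \sum_(j in Q :|: A)
    \sum_(k in Q :|: A) cone r i j k.
  rewrite /cones bigU [X in _ + X]big1 ?addn0 // => i iA.
  rewrite big1 // => j jS; rewrite big1 // => k kS.
  by rewrite /cone (negPf (maxA _ _ iA jS)).
(* The right-hand side is regrouped by the lower point [i]. *)
have -> : cones r Q + \sum_(a in A) legs r Q a +
  \sum_(a in A) \sum_(b in A | a != b) #|below r Q a :&: below r Q b| =
  \sum_(i in Q) (\sum_(j in Q) \sum_(k in Q) cone r i j k
    + (\sum_(j in Q) \sum_(k in A) cone r i j k
    + \sum_(j in A) \sum_(k in Q) cone r i j k)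
    + \sum_(j in A) \sum_(k in A) cone r i j k).
  rewrite !big_split /=; congr (_ + _ + _).
    rewrite /legs.
    under eq_bigr => a _ do rewrite -addnn -big_split /=.
    rewrite exchange_big -big_split /=; apply: eq_bigr => i iQ.
    rewrite big_split /=; congr (_ + _); first rewrite [RHS]exchange_big /=;
      apply: eq_bigr => a aA; apply: eq_bigr => j jQ; rewrite /cone;
      have [nja naj] := neq _ _ jQ aA; have := maxA a j aA;
      rewrite ?nja ?naj inE jQ => /(_ isT) -> /=; rewrite ?andbT.
      by case: (r i a); rewrite //= andbF.
    by [].
  rewrite exchange_big /=; apply: eq_bigr => a aA.
  rewrite exchange_big /= [LHS]big_mkcondr; apply: eq_bigr => b bA.
  rewrite (eq_bigr (fun i => (a != b) && (r i a && r i b) : nat)); last first.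
    move=> i iQ; rewrite /cone maxA ?inE ?bA ?orbT // maxA ?inE ?aA ?orbT //.
    by rewrite !andbT andbA andbC.
  case: ifP => _ /=; last by rewrite big1.
  rewrite -sum1_card big_mkcond [RHS]big_mkcond; apply: eq_bigr => i _.
  by rewrite !inE; case: (i \in Q) => //=; case: (r i a); case: (r i b).
apply: eq_bigr => i iQ; rewrite bigU.
under eq_bigr do rewrite bigU.
under [X in _ + X = _]eq_bigr do rewrite bigU.
by rewrite !big_split /= !addnA.
Qed.

Lemma eq_cones r r' S : {in S &, r =2 r'} -> cones r S = cones r' S.
Proof.
move=> eqr; apply: eq_bigr => i iS; apply: eq_bigr => j jS.
by apply: eq_bigr => k kS; rewrite /cone !eqr.
Qed.

(** Only the second argument is redirected: points of [A] receive the predecessors of [a]. When they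
    are maximal, they have no successors to adjust. *)
Definition clone r (A : {set T}) a : rel T :=
  fun x y => if y \in A then r x a else r x y.

Lemma clone_order r S a : order_on r S -> a \in maximals r S ->
  order_on (clone r (maximals r S) a) S.
Proof.
move=> [irr tr] aM; have /maximalsP[aS _] := aM; rewrite /clone.
split=> [x | x y z xS yS zS].
  by case: ifP => // /maximalsP[_ ->].
case: ifP => [/maximalsP[_ ymax] | _] rxy.
  by case: ifP => _ ryz; [have := ymax _ aS | have := ymax _ zS]; rewrite ryz.
by case: ifP => _ ryz; apply: (tr x y) => //.
Qed.

Lemma sum_other (A : {set T}) b x : b \in A ->
  \sum_(c in A | b != c) x = #|A|.-1 * x.
Proof.
move=> bA; rewrite (cardsD1 b A) bA add1n /= -sum_nat_const.
by apply: eq_bigl => c; rewrite !inE eq_sym andbC.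
Qed.

(** All clones have the same legs and the same predecessors, so the sums over [A] in [cones_split]
    become products. *)
Lemma cones_clone r S a : a \in maximals r S ->
  let A := maximals r S in let Q := S :\: A in
  cones (clone r A a) S =
  cones r Q + #|A| * (legs r Q a + #|A|.-1 * #|below r Q a|).
Proof.
move=> aA A Q; have sAS : A \subset S := maximals_sub r S.
have dQA : [disjoint Q & A] by apply: disjoint_setDl.
have SE : S = Q :|: A by rewrite setDUK.
rewrite {1}SE cones_split //; last first.
  move=> b y bA; rewrite -SE => yS; rewrite /clone.
  have /maximalsP[_ bmax] := bA.
  by case: ifP => _; apply: bmax => //; apply: (subsetP sAS).
have cQ x y : y \in Q -> clone r A a x y = r x y.
  by move=> yQ; rewrite /clone (disjointFr dQA yQ).
have cA x y : y \in A -> clone r A a x y = r x a by rewrite /clone => ->.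
rewrite -addnA mulnDr; congr (_ + (_ + _)).
- by apply: eq_cones => x y _ yQ; apply: cQ.
- rewrite -sum_nat_const; apply: eq_bigr => b bA; congr (_.*2).
  apply: eq_bigr => i iQ; apply: eq_bigr => j jQ.
  by rewrite !(cA _ _ bA) cQ.
- rewrite -sum_nat_const; apply: eq_bigr => b bA.
  rewrite (eq_bigr (fun=> #|below r Q a|)).
    exact: sum_other.
  move=> c /andP[cA' _]; congr #|pred_of_set _|.
  by apply/setP => x; rewrite !inE (cA _ _ bA) (cA _ _ cA') andbb.
Qed.

(** Symmetrization in the manner of Zykov: the common predecessors of [b] and [c] number at most
    those of [b], so each maximal [b] contributes at most its weight [w b], and [a] maximizes
    [w]. *)
Lemma cones_clone_max r S : order_on r S -> S != set0 ->
  exists2 a, a \in maximals r S &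
    cones r S <= cones (clone r (maximals r S) a) S.
Proof.
move=> ro S0; have [a0 a0A] := exists_maximal ro S0.
pose A := maximals r S; pose Q := S :\: A.
pose w a := legs r Q a + #|A|.-1 * #|below r Q a|.
case: (arg_maxnP (P := mem A) w a0A) => a aA amax; exists a => //.
rewrite cones_clone // -/A -/Q -/(w a).
have dQA : [disjoint Q & A] by apply: disjoint_setDl.
have SE : S = Q :|: A by rewrite setDUK // maximals_sub.
rewrite {1}SE cones_split //; last first.
  by move=> b y /maximalsP[_ bmax]; rewrite -SE; apply: bmax.
rewrite -addnA leq_add2l -sum_nat_const -big_split /=.
apply: leq_sum => b bA; apply: leq_trans (amax b bA); rewrite leq_add2l.
rewrite -(sum_other _ bA); apply: leq_sum => c _.
by apply: subset_leq_card; apply: subsetIl.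
Qed.

(** Induction on [#|S|], then on the number of non-maximal points. After cloning, either [a] lies
    above all of [Q] and the recursion for [maxlay] applies with [k = #|Q|], or a new maximal point
    appears. The doubling reflects the ordered upper points. *)
Lemma cones_bound r S : order_on r S -> cones r S <= (maxlay #|S|).*2.
Proof.
have [n] := ubnP #|S|; elim: n r S => // n IHn r S /ltnSE leSn.
have [m] := ubnP #|S :\: maximals r S|; elim: m r => // m IHm r /ltnSE leQm ro.
have [->|S0] := eqVneq S set0.
  by rewrite /cones big_set0.
have [a aA le_a] := cones_clone_max ro S0; apply: leq_trans le_a _.
set A := maximals r S in aA *; set Q := S :\: A in leQm *.
have sAS : A \subset S := maximals_sub r S.
have co := clone_order ro aA.
have [sQa|] := boolP (Q \subset below r Q a).
  rewrite cones_clone // -/A -/Q.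
  have bQ : below r Q a = Q.
    apply/eqP; rewrite eqEsubset sQa andbT.
    by apply/subsetP => x; rewrite inE => /andP[].
  have -> : legs r Q a = 0.
    apply/eqP; rewrite double_eq0; apply/eqP; rewrite big1 // => i _.
    rewrite big1 // => j jQ; move: jQ; rewrite -bQ inE => /andP[_ ->].
    by rewrite !andbF.
  have cQ : #|Q| = #|S| - #|A| by rewrite cardsD (setIidPr sAS).
  have A_gt0 : 0 < #|A| by apply/card_gt0P; exists a.
  have leAS : #|A| <= #|S| by apply: subset_leq_card.
  have ltQS : #|Q| < #|S| by lia.
  have := leq_maxlay ltQS; have -> : #|S| - #|Q| = #|A| by lia.
  have : cones r Q <= (maxlay #|Q|).*2.
    apply: IHn; first exact: leq_trans ltQS leSn.
    case: ro => irr tr; split=> // x y z; rewrite !inE.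
    by move=> /andP[_ xS] /andP[_ yS] /andP[_ zS]; apply: tr.
  have := double_bin2 #|A|; rewrite bQ add0n; nia.
rewrite -setD_eq0 => D0; have [irr tr] := ro.
(* Such an [x] becomes maximal in the clone: a successor in [Q] below [a] would put [x] below [a],
   and the points of [A] now have only the predecessors of [a]. So the second measure drops. *)
have [||x] := @exists_maximal r (Q :\: below r Q a); [|exact: D0|].
  split=> // x y z /setDP[/setDP[xS _] _] /setDP[/setDP[yS _] _].
  by move=> /setDP[/setDP[zS _] _]; apply: tr.
case/maximalsP=> /setDP[xQ xa] xmax; have /setDP[xS xA] := xQ.
have nxa : ~~ r x a by apply: contra xa => rxa; rewrite inE xQ.
apply: IHm co; apply: leq_trans leQm; apply/proper_card/properP; split.
  apply: setDS; apply/subsetP => b bA; have /maximalsP[bS bmax] := bA.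
  apply/maximalsP; split=> // y yS; rewrite /clone.
  by case: ifP => _; apply: bmax => //; apply: (subsetP sAS).
exists x => //; rewrite inE negb_and negbK; apply/orP; left.
apply/maximalsP; split=> // y yS; rewrite /clone; case: ifPn => // yA.
have yQ : y \in Q by apply/setDP.
have [ya|ya] := boolP (y \in below r Q a); last by apply: xmax; apply/setDP.
apply: contra nxa => rxy; move: ya; rewrite inE => /andP[_ rya].
by apply: (tr x y) => //; apply: (subsetP sAS).
Qed.
End Cones.

(** Each copy of 132 yields two cones, one for each order of its upper points, which matches the
    factor 2 in [cones_bound]. *)
Lemma c132_le_maxlay (n : nat) (p : 'S_n) : c132 p <= maxlay n.
Proof.
pose r := [rel i j : 'I_n | (i < j) && (p i < p j)].
have ro : order_on r [set: 'I_n].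
  split=> [x|x y z _ _ _ /=]; first by rewrite /= ltnn.
  move=> /andP[xy pxy] /andP[yz pyz].
  by rewrite (ltn_trans xy) // (ltn_trans pxy).
have := cones_bound ro; rewrite cardsT card_ord => le_cones.
rewrite -leq_double; apply: leq_trans le_cones.
have sumT (F : 'I_n -> nat) : \sum_(i in [set: 'I_n]) F i = \sum_i F i.
  by apply: eq_bigl => i; rewrite inE.
rewrite c132_sum -addnn /cones sumT -big_split /=; apply: leq_sum => i _.
(* One of the two copies of the sum has [j] and [k] swapped. At most one order of the pair gives a
   copy of 132, so the two terms together are bounded by a single cone. *)
rewrite sumT [X in _ + X <= _]exchange_big -big_split /=; apply: leq_sum => j _.
rewrite sumT -big_split /=; apply: leq_sum => k _.
have cone132 (u v : 'I_n) :
    [&& i < u, u < v, p i < p v & p v < p u] -> cone r i u v.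
  by rewrite /cone /= -val_eqE /=; lia.
case v_jk: [&& _, _, _ & _]; case v_kj: [&& _, _, _ & _] => //.
- case/and4P: v_jk => _ ltjk _ _; case/and4P: v_kj => _.
  by rewrite ltnNge ltnW.
- by rewrite (cone132 _ _ v_jk).
- by rewrite coneC (cone132 _ _ v_kj).
Qed.

(** * Attained values: computation for small lengths, then induction *)

(* The clause for [n = 7], [c = 17] is [attained7_17]: this value is not
   obtained from shorter permutations by [attained_sum]. *)
Definition table_step (t : seq (seq bool)) (n : nat) : seq bool :=
  mkseq (fun c => ((n == 7) && (c == 17)) ||
    has (fun k =>
      has (fun j => (k * j <= c) && nth false (nth [::] t k) (c - k * j))
          (iota 0 'C(n - k, 2).+1))
      (iota 0 n))
    (maxlay n).+1.

Fixpoint attained_table (n : nat) : seq (seq bool) :=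
  if n is m.+1 then
    let t := attained_table m in
    rcons t (if m is 0 then [:: true] else table_step t m)
  else [::].

Definition nearly_full (n : nat) : Prop :=
  [/\ attained n (maxlay n),
      attained n (maxlay n - 1) \/ attained n (maxlay n - 2) &
      forall c, c <= maxlay n ->
        [\/ attained n c, c = maxlay n - 1 | c = maxlay n - 2]].

Definition nearly_fullb (t : seq bool) (M : nat) : bool :=
  [&& nth false t M, nth false t (M - 1) || nth false t (M - 2) &
      all (fun c => [|| nth false t c, c == M - 1 | c == M - 2]) (iota 0 M.+1)].

Lemma attained0 : attained 0 0.
Proof. by exists [::]. Qed.

Lemma attained7_17 : attained 7 17.
Proof. by exists [:: 0; 1; 3; 6; 5; 4; 2]. Qed.

Lemma size_attained_table (n : nat) : size (attained_table n) = n.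
Proof. by elim: n => //= n IH; rewrite size_rcons IH. Qed.

(** Lookups outside the table return [false], so a [true] entry comes from length 0, from
    [attained7_17] or from a use of [attained_sum]. *)
Lemma attained_tableP (n k c : nat) :
  nth false (nth [::] (attained_table n) k) c -> attained k c.
Proof.
elim: n k c => [|n IH] k c /=; first by rewrite nth_nil nth_nil.
rewrite nth_rcons size_attained_table; case: ltnP => [_ /IH //|_].
case: eqP => [->|_]; last by rewrite nth_nil.
case: n IH => [|n] IH.
  by case: c => [_|c]; [exact: attained0 | rewrite /= nth_nil].
have [ltc|gec] := ltnP c (maxlay n.+1).+1; last first.
  by rewrite nth_default // size_mkseq.
rewrite /table_step nth_mkseq // => /orP[/andP[/eqP -> /eqP ->]|].
  exact: attained7_17.
case/hasP=> i; rewrite mem_iota add0n => /andP[_ lti] /hasP[j].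
rewrite mem_iota add0n ltnS => /andP[_ lej] /andP[lejc /IH att].
by have := attained_sum att lej; rewrite subnK // subnKC // ltnW.
Qed.

Lemma nearly_full_small (n : nat) : n < 16 -> nearly_full n.
Proof.
move=> ltn16.
suff : let t := attained_table 16 in
    all (fun n => nearly_fullb (nth [::] t n) (maxlay n)) (iota 0 16).
  move/allP/(_ n); rewrite mem_iota => /(_ ltn16) /and3P[h1 h2 /allP h3]; split.
  - exact: attained_tableP h1.
  - by case/orP: h2 => /attained_tableP; [left | right].
  - move=> c lec; have /h3 : c \in iota 0 (maxlay n).+1 by rewrite mem_iota.
    case/or3P => [/attained_tableP | /eqP | /eqP].
    + exact: Or31.
    + exact: Or32.
    + exact: Or33.
by vm_compute.
Qed.

(** For [n >= 2] this is the term [k = 1] of the recursion. *)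
Lemma maxlay_ge (n : nat) : 'C(n.-1, 2) <= maxlay n.
Proof.
case: n => // -[//|n]; apply: leq_trans (leq_maxlay (isT : 1 < n.+2)).
by rewrite mul1n subn1 leq_addl.
Qed.

Lemma maxlay_opt_ge6 (n : nat) : 16 <= n ->
  exists2 k, 6 <= k < n & maxlay n = maxlay k + k * 'C(n - k, 2).
Proof.
move=> n16; have [|k ltkn ek] := @maxlay_attained n; first by lia.
have [le6k|ltk6] := leqP 6 k; first by exists k => //; rewrite le6k.
(* From [n = 16] on, 6 beats every smaller [k]. The tightest case is [k = 5] at [n = 16], with 282
   against 281. *)
exists 6; first by lia.
apply/eqP; rewrite eqn_leq leq_maxlay ?andbT; last by lia.
rewrite ek; have [x ->] : exists x, n = 16 + x by exists (n - 16); lia.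
have -> : maxlay 6 = 12 by vm_compute.
have le6 : maxlay k <= 6.
  by move: ltk6 {ek ltkn}; case: k => [|[|[|[|[|[|//]]]]]] _; vm_compute.
have := double_bin2 (16 + x - 6); have := double_bin2 (16 + x - k).
by move: ltk6 le6 {ek ltkn}; case: k => [|[|[|[|[|[|//]]]]]] _; nia.
Qed.

Lemma nearly_full_all (n : nat) : nearly_full n.
Proof.
have [m] := ubnP n; elim: m n => // m IH n /ltnSE lenm.
have [|n16] := ltnP n 16; first exact: nearly_full_small.
have [k /andP[k6 ltkn] ek] := maxlay_opt_ge6 n16.
have [att1 att2 att3] := IH k (leq_trans ltkn lenm).
have lift a j : attained k a -> j <= 'C(n - k, 2) -> attained n (a + k * j).
  by move=> /attained_sum h /h; rewrite subnKC // ltnW.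
(* Hence every remainder modulo [k] lies below both exceptional values [maxlay k - 2] and
   [maxlay k - 1], and these subtractions are not truncated. *)
have Mk : k.+2 <= maxlay k.
  apply: leq_trans (maxlay_ge k).
  rewrite -(subnK k6) addnS /=; elim: (k - 6) => // y IHy.
  by rewrite addSn binS bin1; lia.
have top a : attained k a -> attained n (a + k * 'C(n - k, 2)).
  by move=> /lift; apply.
rewrite /nearly_full ek; split; first exact: top.
  by case: att2 => /top h; [left | right]; move: h; congr attained; lia.
move=> c lec; have [ltc|gec] := ltnP c (k * 'C(n - k, 2)).
  (* The remainder is the number of copies in the lower block, the quotient the number of inversions
     in the upper one. *)
  apply: Or31; rewrite (divn_eq c k) addnC mulnC; apply: lift.
    have := ltn_pmod c (_ : 0 < k); rewrite (leq_trans _ k6) // => /(_ isT) ltr.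
    by case: (att3 (c %% k)) => //; lia.
  by apply: ltnW; rewrite ltn_divLR 1?mulnC //; lia.
have [|h|h|h] := att3 (c - k * 'C(n - k, 2)); first by lia.
- by apply: Or31; have := top _ h; rewrite subnK.
- by apply: Or32; lia.
- by apply: Or33; lia.
Qed.

(** * Transfer to [M132], [S132] and internal zeros *)

Lemma M132_maxlay (n : nat) : M132 n = maxlay n.
Proof.
apply/eqP; rewrite eqn_leq; apply/andP; split.
  by apply/bigmax_leqP => p _; apply: c132_le_maxlay.
have [/attained_perm[p <-] _ _] := nearly_full_all n.
exact: leq_bigmax.
Qed.

Lemma S132_neq0 (n c : nat) : S132 n c <> 0 <-> exists p : 'S_n, c132 p = c.
Proof.
split=> [/eqP|[p pc]]; last apply/eqP; rewrite cards_eq0.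
  by case/set0Pn=> p; rewrite inE => /eqP <-; exists p.
by apply/set0Pn; exists p; rewrite inE pc.
Qed.

Lemma attained_S132 (n c : nat) : attained n c -> S132 n c <> 0.
Proof. by move/attained_perm/S132_neq0. Qed.

(* Subtraction on nat is truncated, but harmlessly: an internal zero c has
   0 < c < M132 n, and 0 is never an internal zero, so wherever truncation
   could matter the predicate is false. *)
Theorem theorem4p3 (n : nat) (n_gt0 : 0 < n) :
  (forall c : nat, internal_zero n c -> c = M132 n - 1 \/ c = M132 n - 2) /\
  ~ (internal_zero n (M132 n - 1) /\ internal_zero n (M132 n - 2)).
Proof.
rewrite M132_maxlay; have [_ att2 att3] := nearly_full_all n; split.
  move=> c [S0 [_ [c2 [_ ltc /= _ /S132_neq0[p pc]]]]].
  case: (att3 c); [|by move/attained_S132|by left|by right].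
  by rewrite ltnW // (leq_trans ltc) // -pc c132_le_maxlay.
by case=> -[S1 _] [S2 _]; case: att2 => /attained_S132.
Qed.
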